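(* Let $p$ be a prime, let $k\ge 1$, and let $G=\prod_{i=1}^{k}\mathbb{Z}_{p^{\alpha_i}}$ be a finite abelian $p$-group, where $1\leq\alpha_1\leq\alpha_2\leq\dots\leq\alpha_k$ are integers. Then $$\psi(G)=1+\sum_{\alpha=1}^{\alpha_k}\left(p^{2\alpha}f_{(\alpha_1,\alpha_2,\dots,\alpha_k)}(\alpha)-p^{2\alpha-1}f_{(\alpha_1,\alpha_2,\dots,\alpha_k)}(\alpha-1)\right),$$ where, for integers $\alpha\ge 0$, $$f_{(\alpha_1,\alpha_2,\dots,\alpha_k)}(\alpha)=\begin{cases} p^{(k-1)\alpha}, & \text{if } 0\le\alpha\le\alpha_1,\\ p^{(k-2)\alpha+\alpha_1}, & \text{if } \alpha_1\le\alpha\le\alpha_2,\\ \ \vdots & \\ p^{\alpha_1+\alpha_2+\dots+\alpha_{k-1}}, & \text{if } \alpha_{k-1}\le\alpha.\end{cases}$$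
   Context: For a finite group $G$, $\psi(G)=\sum_{a\in G}o(a)$, where $o(a)$ denotes the order of the element $a\in G$. $\mathbb{Z}_m$ denotes the cyclic group of order $m$. In the piecewise definition of $f$, with the convention $\alpha_0=0$, the value for $\alpha_{j}\le\alpha\le\alpha_{j+1}$ ($0\le j\le k-2$) is $p^{(k-1-j)\alpha+\alpha_1+\dots+\alpha_j}$, and the value for all $\alpha\ge\alpha_{k-1}$ is $p^{\alpha_1+\dots+\alpha_{k-1}}$; for $k=1$ the function $f$ is constantly equal to $1$. *)

(* Defs.v *)
From HB Require Import structures.
From mathcomp Require Import all_boot all_order all_algebra all_fingroup.
From mathcomp Require Import cyclic.

Set Implicit Arguments.
Unset Strict Implicit.
Unset Printing Implicit Defensive.

Definition psi (gT : finGroupType) (G : {group gT}) : nat :=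
  \sum_(a in G) #[a]%g.

(* 1-based indexing of the exponents, so that part alpha 0 = 0 is the
   convention alpha_0 = 0. *)
Definition part (alpha : seq nat) (j : nat) : nat := nth 0 (0 :: alpha) j.

(* Each MathComp type 'Z_n carries its additive group structure, and
   {dffun forall i, _} carries the external direct product.  'Z_n is Z/nZ only
   for n > 1, i.e. here when p > 1 and every exponent is positive. *)
Definition prodZ (p k : nat) (alpha : k.-tuple nat) : finGroupType :=
  {dffun forall i : 'I_k, 'Z_(p ^ tnth alpha i)}.

(* The intervals [alpha_j, alpha_(j+1)], 0 <= j <= k - 2, overlap at their
   endpoints; lemma fE_mid shows that the choice made by pick is immaterial.
   For sorted alpha, no j qualifies only if alpha_(k-1) < a or k <= 1. *)
Definition f (p : nat) (alpha : seq nat) (a : nat) : nat :=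
  let k := size alpha in
  if [pick j : 'I_k.-1 | part alpha j <= a <= part alpha j.+1] is Some j
  then p ^ ((k - 1 - j) * a + \sum_(1 <= i < j.+1) part alpha i)
  else p ^ (\sum_(1 <= i < k) part alpha i).

Lemma part_mono (alpha : seq nat) i j : sorted leq alpha ->
  i <= j <= size alpha -> part alpha i <= part alpha j.
Proof.
move=> so /andP[ij js]; rewrite /part.
have so0 : sorted leq (0 :: alpha) by case: alpha so {js}.
by apply: (sorted_leq_nth leq_trans leqnn) => //; rewrite inE /= ltnS // (leq_trans ij).
Qed.

Lemma f_exp_aux (alpha : seq nat) i j a : sorted leq alpha ->
  i <= j <= (size alpha).-1 -> a <= part alpha i.+1 -> part alpha j <= a ->
  (size alpha - 1 - i) * a + \sum_(1 <= l < i.+1) part alpha l =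
  (size alpha - 1 - j) * a + \sum_(1 <= l < j.+1) part alpha l.
Proof.
move=> so /andP[ij js] ai ja.
have sz : j <= size alpha := leq_trans js (leq_pred _).
have mid : \sum_(i.+1 <= l < j.+1) part alpha l = (j - i) * a.
  transitivity (\sum_(i.+1 <= l < j.+1) a); last first.
    by rewrite sum_nat_const_nat subSS.
  apply: eq_big_nat => l /andP[il lj]; apply/eqP; rewrite eqn_leq.
  have ub : part alpha l <= part alpha j by apply: part_mono; rewrite // -ltnS lj.
  have lb : part alpha i.+1 <= part alpha l.
    apply: part_mono => //; apply/andP; split=> //.
    by apply: leq_trans sz; rewrite -ltnS.
  by rewrite (leq_trans ub ja) (leq_trans ai lb).
have spl := @big_cat_nat _ 0 addn i.+1 1 j.+1 predT (part alpha) isT ij.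
have -> : size alpha - 1 - i = (size alpha - 1 - j) + (j - i).
  by rewrite subn1 addnBA // subnK.
by rewrite spl mid mulnDl [RHS]addnA; apply: addnAC.
Qed.

Lemma fE_mid p (alpha : seq nat) j a : sorted leq alpha ->
  j < (size alpha).-1 -> part alpha j <= a <= part alpha j.+1 ->
  f p alpha a =
  p ^ ((size alpha - 1 - j) * a + \sum_(1 <= i < j.+1) part alpha i).
Proof.
move=> so jk ja; rewrite /f; case: pickP => [i ia|/(_ (Ordinal jk))]; last by rewrite /= ja.
congr (p ^ _); have ik := ltn_ord i.
case/andP: ia => ia1 ia2; case/andP: ja => ja1 ja2.
case: (leqP i j) => [ij|/ltnW ij].
  by apply: f_exp_aux; rewrite // ij ltnW.
by symmetry; apply: f_exp_aux; rewrite // ij ltnW.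
Qed.

Lemma fE_last p (alpha : seq nat) a : sorted leq alpha ->
  0 < size alpha -> part alpha (size alpha).-1 <= a ->
  f p alpha a = p ^ (\sum_(1 <= i < size alpha) part alpha i).
Proof.
move=> so k0 ka; rewrite /f; case: pickP => [i /andP[_ ia2]|//].
congr (p ^ _); have ik := ltn_ord i.
rewrite (@f_exp_aux _ i (size alpha).-1) ?(ltnW ik) ?leqnn //.
by rewrite prednK // subn1 subnn.
Qed.

(* Main.v *)
Require Import Defs.
From HB Require Import structures.
From mathcomp Require Import all_boot all_order all_algebra all_fingroup.
From mathcomp Require Import cyclic abelian.
Import GRing.Theory.
Local Open Scope ring_scope.

(** Let N a be the number of solutions of x ^ (p ^ a) = 1 in G.  The elements of
    order exactly p ^ a number N a - N (a - 1), so grouping the elements of G by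
    order gives
      psi G = 1 + \sum_(1 <= a <= n) p ^ a * (N a - N (a - 1))
    as soon as the exponent of G divides p ^ n ([psi_Ldiv]); here n = alpha_k
    will do ([exponent_prodZ]).

    The numbers N a are isomorphism invariants and multiplicative over direct
    products ([card_Ldiv_dffun]), and a cyclic group of order m has gcdn n m
    solutions of x ^ n = 1 ([card_Ldiv_cyclic]).  Hence, in the given product,
    N a is the product of the p ^ min(a, alpha_i) over 1 <= i <= k.

    On the other side, for a sorted alpha, the piecewise function f is the
    product of the same factors over i < k ([f_minn]): on the interval
    [alpha_j, alpha_(j+1)] the first j minima are the alpha_i and the others
    are a.  For a <= alpha_k the missing factor is p ^ a, so that
    N a = p ^ a * f a, and the two sums agree term by term. *)

(** For m dividing the order of a generator x, the solutions of y ^ m = 1 form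
    the subgroup generated by x ^ (#[x] / m), of order m; and the equation
    y ^ n = 1 only depends on gcdn n #[x]. *)
Lemma card_Ldiv_cyclic (gT : finGroupType) (G : {group gT}) n :
  cyclic G -> (#|('Ldiv_n(G))%g| = gcdn n #|G|)%N.
Proof.
case/cyclicP=> x defG; rewrite defG -orderE.
set m := gcdn n #[x]%g; have m_x : (m %| #[x]%g)%N by apply: dvdn_gcdr.
have x_gt0 : (0 < #[x]%g)%N := order_gt0 x.
have m_gt0 : (0 < m)%N := dvdn_gt0 x_gt0 m_x.
pose z := (x ^+ (#[x] %/ m))%g.
have oz : (#[z]%g = m)%N.
  rewrite /z orderXdiv ?dvdn_div //; apply/eqP; rewrite eq_sym.
  by rewrite eqn_div ?dvdn_div ?divn_gt0 ?(dvdn_leq x_gt0) // mulnC divnK.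
rewrite -oz orderE; apply: eq_card => y.
apply/LdivP/idP => [[/cycleP[i ->] /eqP xin] | /cycleP[i ->]]; last first.
  split; first by rewrite groupX // mem_cycle.
  apply/eqP; rewrite -order_dvdn; apply: dvdn_trans (dvdn_gcdl n #[x]%g).
  by rewrite -/m -oz orderXdvd.
have xim : (#[x]%g %| i * m)%N.
  by rewrite /m muln_gcdr dvdn_gcd -expgM -order_dvdn in xin *; rewrite xin dvdn_mull.
have /dvdnP[c ->] : (#[x]%g %/ m %| i)%N by rewrite dvdn_divLR.
by rewrite mulnC expgM mem_cycle.
Qed.

Lemma card_Ldiv_isog (gT rT : finGroupType) (G : {group gT}) (H : {group rT}) n :
  (G \isog H)%g -> (#|('Ldiv_n(G))%g| = #|('Ldiv_n(H))%g|)%N.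
Proof.
case/isogP=> h injh <-; rewrite -(injm_Ldiv injh n G).
by rewrite card_injm // subsetIl.
Qed.

Lemma expg_dffun (I : finType) (gT : I -> finGroupType)
    (x : {dffun forall i, gT i}) n i : ((x ^+ n) i = x i ^+ n)%g.
Proof. by apply: (morphX (dffun_morphism gT i)); rewrite inE. Qed.

Lemma card_Ldiv_dffun (I : finType) (gT : I -> finGroupType) n :
  (#|('Ldiv_n([set: {dffun forall i, gT i}]))%g| =
   \prod_i #|('Ldiv_n([set: gT i]))%g|)%N.
Proof.
rewrite -(cardsXn (fun i => 'Ldiv_n([set: gT i])%g)); apply: eq_card => x.
apply/LdivP/setXnP => [[_ xn1] i | xn1].
  by rewrite !inE -expg_dffun xn1 oneg_ffun eqxx.
split; first by rewrite inE.
by apply/ffunP => i; have:= xn1 i; rewrite !inE -expg_dffun oneg_ffun => /eqP.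
Qed.

Lemma card_Ldiv_Zp m n : (1 < m)%N ->
  (#|('Ldiv_n([set: 'Z_m]))%g| = gcdn n m)%N.
Proof.
move=> m_gt1; rewrite card_Ldiv_cyclic ?cardsT ?card_ord ?Zp_cast //.
by apply/cyclicP; exists Zp1; rewrite -Zp_cycle.
Qed.

Lemma gcdn_expn p a b : (gcdn (p ^ a) (p ^ b) = p ^ minn a b)%N.
Proof.
case: (leqP a b) => [ab | /ltnW ba]; first exact/gcdn_idPl/dvdn_exp2l.
exact/gcdn_idPr/dvdn_exp2l.
Qed.

Lemma card_Ldiv_prodZ p k (alpha : k.-tuple nat) a :
  prime p -> (forall i, 1 <= tnth alpha i)%N ->
  (#|('Ldiv_(p ^ a)([set: prodZ p alpha]))%g| =
   p ^ \sum_(1 <= i < k.+1) minn a (part alpha i))%N.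
Proof.
move=> pr_p alpha_ge1.
rewrite (card_Ldiv_dffun _ (fun i => 'Z_(p ^ tnth alpha i) : finGroupType)).
rewrite big_add1 big_mkord expn_sum; apply: eq_bigr => i _.
rewrite card_Ldiv_Zp ?gcdn_expn; first by rewrite (tnth_nth 0%N).
by rewrite -(exp1n (tnth alpha i)) ltn_exp2r ?prime_gt1.
Qed.

Lemma exponent_prodZ p k (alpha : k.-tuple nat) :
  prime p -> (forall i, 1 <= tnth alpha i)%N -> sorted leq alpha ->
  (exponent [set: prodZ p alpha] %| p ^ part alpha k)%N.
Proof.
move=> pr_p alpha_ge1 so; apply/exponentP=> x _; apply/ffunP => i.
rewrite (@expg_dffun _ (fun i => 'Z_(p ^ tnth alpha i) : finGroupType)) oneg_ffun.
apply/eqP; rewrite -order_dvdn.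
apply: dvdn_trans (order_dvdG (in_setT _)) _.
rewrite cardsT card_ord Zp_cast; last first.
  by rewrite -(exp1n (tnth alpha i)) ltn_exp2r ?prime_gt1.
apply: dvdn_exp2l; rewrite (tnth_nth 0%N).
by apply: (@part_mono alpha i.+1 k); rewrite // size_tuple ltn_ord leqnn.
Qed.

(** The divisors of p ^ a.+1 are those of p ^ a and p ^ a.+1 itself, so all the
    solutions gained from a to a.+1 have order p ^ a.+1. *)
Lemma sum_order_Ldiv_S (gT : finGroupType) (G : {group gT}) p a : prime p ->
  (\sum_(x in ('Ldiv_(p ^ a.+1)(G))%g) #[x]%g)%N%:Z =
  (\sum_(x in ('Ldiv_(p ^ a)(G))%g) #[x]%g)%N%:Z
  + (p ^ a.+1)%N%:Z * (#|('Ldiv_(p ^ a.+1)(G))%g|%:Z - #|('Ldiv_(p ^ a)(G))%g|%:Z).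
Proof.
move=> pr_p; set A := ('Ldiv_(p ^ a)(G))%g; set B := ('Ldiv_(p ^ a.+1)(G))%g.
have sAB : A \subset B.
  apply/subsetP=> x; rewrite !inE -!order_dvdn => /andP[-> /=] /dvdn_trans->//.
  exact: dvdn_exp2l.
have new : (\sum_(x in B :\: A) #[x]%g = #|B :\: A| * p ^ a.+1)%N.
  rewrite -sum_nat_const; apply: eq_bigr => x; rewrite !inE -!order_dvdn.
  case/andP=> xA /andP[Gx]; rewrite Gx /= in xA *.
  case/(dvdn_pfactor _ _ pr_p)=> b; rewrite leq_eqVlt => /predU1P[-> // | ba] ox.
  by rewrite ox dvdn_exp2l in xA.
rewrite (big_setID A) /= (setIidPr sAB) new PoszD PoszM mulrC.
by rewrite cardsD (setIidPr sAB) -subzn // subset_leq_card.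
Qed.

Lemma psi_Ldiv (gT : finGroupType) (G : {group gT}) p n :
  prime p -> (exponent G %| p ^ n)%N ->
  (psi G)%:Z = 1 + \sum_(1 <= a < n.+1) (p ^ a)%N%:Z *
    (#|('Ldiv_(p ^ a)(G))%g|%:Z - #|('Ldiv_(p ^ (a - 1))(G))%g|%:Z).
Proof.
move=> pr_p expG.
have defG : ('Ldiv_(p ^ n)(G))%g = G by apply/setIidPl; rewrite sub_LdivT.
rewrite /psi -[in LHS]defG {expG defG}; elim: n => [|n IHn].
  rewrite big_geq // addr0 expn0; congr Posz.
  transitivity (\sum_(x in [set 1%g : gT]) #[x]%g)%N; last by rewrite big_set1 order1.
  apply: eq_bigl => x; rewrite !inE expg1.
  by case: eqP => [->|]; rewrite ?group1 ?andbF.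
by rewrite sum_order_Ldiv_S // IHn (big_nat_recr n.+1) //= subn1 addrA.
Qed.

Lemma f_minn p (alpha : seq nat) a : sorted leq alpha ->
  f p alpha a = (p ^ \sum_(1 <= i < size alpha) minn a (part alpha i))%N.
Proof.
move=> so; rewrite /f; case: pickP => [j /andP[ja aj] | none]; congr (p ^ _)%N.
  have jk : (j.+1 < size alpha)%N by rewrite -ltn_predRL ltn_ord.
  rewrite [RHS](@big_cat_nat _ _ _ j.+1) ?(ltnW jk) //= addnC; congr (_ + _)%N.
    apply: eq_big_nat => i /andP[_ ij]; apply/esym/minn_idPr.
    apply: leq_trans ja; apply: part_mono; rewrite // -ltnS ij /=.
    by do 2!apply: ltnW.
  rewrite -subnDA add1n -sum_nat_const_nat; apply: eq_big_nat => i /andP[ji ik].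
  by apply/esym/minn_idPl/(leq_trans aj)/part_mono; rewrite // ji ltnW.
(* If a lies in none of the intervals, it lies beyond all of them: it cannot
   cross any part alpha j, as part alpha 0 = 0 is below a. *)
have below j : (j < size alpha)%N -> (part alpha j <= a)%N.
  elim: j => [|j IHj] jk; first exact: leq0n.
  have /= := none (Ordinal (etrans (ltn_predRL _ _) jk)).
  by rewrite IHj ?(ltnW jk) //= leqNgt => /negbFE/ltnW.
by apply: eq_big_nat => i /andP[_ ik]; apply/esym/minn_idPr/below.
Qed.

Theorem theorem1 (p k : nat) (alpha : k.-tuple nat)
    (gT : finGroupType) (G : {group gT})
    (p_prime : prime p) (k_ge1 : (1 <= k)%N)
    (alpha_ge1 : forall i : 'I_k, (1 <= tnth alpha i)%N)
    (alpha_sorted : sorted leq alpha)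
    (G_prod : (G \isog [set: prodZ p alpha])%g) :
  (psi G)%:Z =
    1 + \sum_(1 <= a < (part alpha k).+1)
          ((p ^ (2 * a) * f p alpha a)%N%:Z
           - (p ^ (2 * a - 1) * f p alpha (a - 1))%N%:Z).
Proof.
have cardN a : #|('Ldiv_(p ^ a)(G))%g| =
    (p ^ \sum_(1 <= i < k.+1) minn a (part alpha i))%N.
  by rewrite (card_Ldiv_isog _ _ _ _ _ G_prod) card_Ldiv_prodZ.
have cardNf a : (a <= part alpha k)%N ->
    #|('Ldiv_(p ^ a)(G))%g| = (p ^ a * f p alpha a)%N.
  move=> ak; rewrite cardN f_minn // size_tuple big_nat_recr //= expnD mulnC.
  by rewrite (minn_idPl ak).
rewrite (@psi_Ldiv _ _ p (part alpha k)) //; last first.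
  by rewrite (exponent_isog G_prod) exponent_prodZ.
congr (1 + _); apply: eq_big_nat => a /andP[a_gt0 ak]; rewrite ltnS in ak.
have a1k : (a - 1 <= part alpha k)%N by rewrite (leq_trans (leq_subr _ _)).
rewrite !cardNf // mulrBr -!PoszM !mulnA -!expnD mul2n -addnn.
by rewrite addnBA.
Qed.
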